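(* Let $(\Omega,\mathcal{A},\mathbb{P})$ be a probability space and let $\mu$ be a maximal partial measure on $\mathcal{A}$ that is absolutely continuous with respect to $\mathbb{P}$, i.e., for $A\in\mathcal{A}$, $\mathbb{P}(A)=0$ implies $A\in\mathcal{D}(\mu)$ and $\mu(A)=0$. Then there exists a random variable $\xi:\Omega\to\overline{\mathbb{R}}$, unique up to $\mathbb{P}$-almost sure equality, such that $\mu=\mu_\xi$ (equality of partial measures, including equality of domains), where $\mu_\xi(A)=\int_A\xi\,d\mathbb{P}$.
   Context: $\overline{\mathbb{R}}=\mathbb{R}\cup\{-\infty\}\cup\{+\infty\}$ is the extended real line. A measure on a $\sigma$-algebra $\mathcal{A}$ is a $\sigma$-additive set function $\mu:\mathcal{A}\to\overline{\mathbb{R}}$ with $\mu(\emptyset)=0$ (so it takes at most one of the values $+\infty,-\infty$). A set function $\mu:\mathcal{D}(\mu)\to\overline{\mathbb{R}}$ defined on a nonvoid subclass $\mathcal{D}(\mu)\subset\mathcal{A}$ is called a partial measure on $\mathcal{A}$ if for every $B\in\mathcal{D}(\mu)$ the restriction $\mu|_{\mathcal{A}\cap B}$ is a measure on the $\sigma$-algebra $\mathcal{A}\cap B=\{A\cap B: A\in\mathcal{A}\}$ (in particular $\mathcal{A}\cap B\subset\mathcal{D}(\mu)$). A partial measure is maximal if it has no proper extension to a partial measure on $\mathcal{A}$. For a random variable ($\mathcal{A}$-measurable function) $\xi:\Omega\to\overline{\mathbb{R}}$, $\mu_\xi$ denotes the partial measure on $\mathcal{A}$ with domain $\mathcal{D}(\mu_\xi)=\{A\in\mathcal{A}:\xi\text{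 is quasiintegrable over }A\}$, given by $\mu_\xi(A)=\int_A\xi\,d\mathbb{P}$; here $\xi$ is quasiintegrable over $A$ if at least one of $\int_A\max(\xi,0)\,d\mathbb{P}$, $\int_A\max(-\xi,0)\,d\mathbb{P}$ is finite. *)

(* Defs.v *)
From mathcomp Require Import all_boot all_order all_algebra.
From mathcomp Require Import all_classical all_reals all_analysis measurable_realfun.

Set Implicit Arguments.
Unset Strict Implicit.
Unset Printing Implicit Defensive.

Import Order.TTheory GRing.Theory Num.Theory.
Import numFieldNormedType.Exports.

Local Open Scope classical_set_scope.
Local Open Scope ring_scope.
Local Open Scope ereal_scope.

(* A partial function from sets to the extended reals: values of [sf_val]
   outside [sf_dom] are junk and are ignored by [sf_ext] and [sf_eq]. *)
Record set_function (T : Type) (R : realType) := SetFunction {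
  sf_dom : set (set T) ;
  sf_val :> set T -> \bar R }.

Definition sf_ext (T : Type) (R : realType) (nu mu : set_function T R) :=
  sf_dom mu `<=` sf_dom nu /\ (forall A, sf_dom mu A -> nu A = mu A).

Definition sf_eq (T : Type) (R : realType) (mu nu : set_function T R) :=
  sf_dom mu = sf_dom nu /\ (forall A, sf_dom mu A -> mu A = nu A).

(* Signed, possibly infinite, measure on the sigma-algebra [G].
   As [+oo + -oo = -oo] by convention in [\bar R], the exclusion of one of the
   two infinite values is what makes the sums below meaningful. *)
Definition ext_measure_on (T : Type) (R : realType) (G : set (set T))
    (m : set T -> \bar R) :=
  [/\ m set0 = 0,
      (forall A, G A -> m A != +oo) \/ (forall A, G A -> m A != -oo) &
      forall F : (set T)^nat, (forall i, G (F i)) -> trivIset setT F ->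
        (fun n => \sum_(0 <= i < n) m (F i)) @ \oo --> m (\bigcup_n F n)].

Definition partial_measure d (T : measurableType d) (R : realType)
    (mu : set_function T R) :=
  [/\ sf_dom mu !=set0,
      sf_dom mu `<=` measurable &
      forall B, sf_dom mu B ->
        strace measurable B `<=` sf_dom mu /\
        ext_measure_on (strace measurable B) mu].

Definition maximal_partial_measure d (T : measurableType d) (R : realType)
    (mu : set_function T R) :=
  partial_measure mu /\
  (forall nu, partial_measure nu -> sf_ext nu mu -> sf_eq nu mu).

Definition abs_continuous d (T : measurableType d) (R : realType)
    (mu : set_function T R) (P : probability T R) :=
  forall A, measurable A -> P A = 0 -> sf_dom mu A /\ mu A = 0.

Definition quasiintegrable d (T : measurableType d) (R : realType)
    (P : probability T R) (A : set T) (xi : T -> \bar R) :=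
  (\int[P]_(x in A) xi^\+ x \is a fin_num) \/
  (\int[P]_(x in A) xi^\- x \is a fin_num).

Definition mu_of d (T : measurableType d) (R : realType)
    (P : probability T R) (xi : T -> \bar R) : set_function T R :=
  SetFunction [set A | measurable A /\ quasiintegrable P A xi]
              (fun A => \int[P]_(x in A) xi x).

(* Main.v *)
Require Import Defs.
From HB Require Import structures.
From mathcomp Require Import all_boot all_order all_algebra.
From mathcomp Require Import all_classical all_reals all_analysis measurable_realfun.

(** Call [A] good when [mu A] is defined and [mu] has a density with respect to
    [P] on the measurable subsets of [A].

    Good sets are plentiful ([exists_has_density]): every set of the domain of
    positive probability contains a good one of positive probability.  On a set
    of finite [mu], the trace of [mu] is a finite charge and the classical
    Radon-Nikodym theorem applies ([fin_num_has_density]).  If a set [B] has no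
    good subset of positive probability, then [mu] is infinite on each of its
    non-null subsets, always with the same sign because [mu] is a measure on
    [B]; so [mu] is [+oo * P] or [-oo * P] on [B], the density is a constant
    and [B] itself is good.  This replaces a Hahn decomposition of infinite
    signed measures.

    As [P] is finite, an exhaustion argument ([exhaustion_sequence]) gives
    countably many disjoint good sets [A n] such that every good set disjoint
    from their union is null, hence every set of the domain is covered by them
    up to a null set.  Gluing their densities yields one function [xi]
    ([exists_density]).  Sigma-additivity of [mu] and of the integral gives
    [mu B = \int_B xi] as soon as [xi] is quasi-integrable over [B].

    Quasi-integrability over each [B] of the domain is the only point where
    the two infinite values could meet ([sf_ext_density]).  On the parts of [B]
    where [xi <= 0] and where [xi >= 0], the integral of [xi] makes sense and is
    the value of [mu]; since [mu] omits one infinite value below [B], one of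
    these two integrals is finite.  So [mu_of P xi] extends [mu], and
    as it is a partial measure ([mu_of_partial_measure]), maximality makes the
    two equal.

    For uniqueness ([ae_le_of_sf_eq]), if [mu_of P xi = mu_of P eta], compare
    the integrals of [xi] and [eta] over [eta <= r < s <= xi] with [r], [s]
    rational: they are equal, the first is at least [s * P], the second at most
    [r * P], so that this set is null. *)

Set Implicit Arguments.
Unset Strict Implicit.
Unset Printing Implicit Defensive.

Import Order.TTheory GRing.Theory Num.Theory.

Local Open Scope classical_set_scope.
Local Open Scope ring_scope.
Local Open Scope ereal_scope.

(** * Equality of partial set functions *)

Lemma sf_eq_sym (T : Type) (R : realType) (mu nu : set_function T R) :
  sf_eq mu nu -> sf_eq nu mu.
Proof. by move=> [D E]; split=> [//|A]; rewrite -D => /E. Qed.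

Lemma sf_eq_trans (T : Type) (R : realType) (mu nu rho : set_function T R) :
  sf_eq mu nu -> sf_eq nu rho -> sf_eq mu rho.
Proof.
by move=> [D E] [D' E']; split=> [|A DA]; [rewrite D|rewrite E// E'// -D].
Qed.

(** * Quasi-integrable functions *)

Lemma ereal_rat_between (R : realType) (x y : \bar R) : x < y ->
  exists q : rat, x < (ratr q)%:E < y.
Proof.
have between (a b : R) : (a < b)%R ->
    exists q : rat, a%:E < (ratr q)%:E < b%:E.
  by move=> /rat_in_itvoo[q]; rewrite in_itv/= => qab; exists q; rewrite !lte_fin.
case: x => [a| |]; case: y => [b| |]//.
- by rewrite lte_fin; exact: between.
- have /between[q /andP[aq _]] : (a < a + 1)%R by rewrite ltrDl.
  by exists q; rewrite aq ltry.
- have /between[q /andP[_ qb]] : (b - 1 < b)%R by rewrite ltrBlDr ltrDl.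
  by exists q; rewrite qb ltNyr.
- by exists 0%R; rewrite ltry ltNyr.
Qed.

Section quasiintegrable.
Context d (T : measurableType d) (R : realType) (P : probability T R).
Implicit Types (A B : set T) (f g xi : T -> \bar R).

(** Both parts of the canonical decomposition are monotone, so that no
    integrability is needed, even with the convention [+oo - +oo = -oo]. *)
Lemma le_integral_of_le B f g : measurable B ->
  measurable_fun B f -> measurable_fun B g -> (forall x, B x -> f x <= g x) ->
  \int[P]_(x in B) f x <= \int[P]_(x in B) g x.
Proof.
move=> mB mf mg fg; rewrite (integralE P B f) (integralE P B g).
apply: leeB; apply: ge0_le_integral => //.
- exact: measurable_funepos.
- exact: measurable_funepos.
- move=> x Bx; apply: (@funepos_le _ _ B); last exact/mem_set.
  by move=> y /set_mem; exact: fg.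
- exact: measurable_funeneg.
- exact: measurable_funeneg.
- move=> x Bx; apply: (@funeneg_le _ _ B); last exact/mem_set.
  by move=> y /set_mem; exact: fg.
Qed.

Lemma quasiintegrableS A B xi : measurable A -> measurable B -> A `<=` B ->
  measurable_fun B xi -> quasiintegrable P B xi -> quasiintegrable P A xi.
Proof.
move=> mA mB AB mxi.
have fin g : measurable_fun B g -> (forall x, 0 <= g x) ->
    \int[P]_(x in B) g x \is a fin_num -> \int[P]_(x in A) g x \is a fin_num.
  move=> mg g0; rewrite !ge0_fin_numE ?integral_ge0//; apply: le_lt_trans.
  exact: ge0_subset_integral.
move=> [qB|qB]; [left|right]; apply: fin qB.
- exact: measurable_funepos.
- by move=> x; rewrite funepos_ge0.
- exact: measurable_funeneg.
- by move=> x; rewrite funeneg_ge0.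
Qed.

Lemma le0_quasiintegrable A xi :
  (forall x, A x -> xi x <= 0) -> quasiintegrable P A xi.
Proof.
by move=> xi0; left; rewrite (eq_integral _ _ (le0_funeposE xi0)) integral0.
Qed.

Lemma ge0_quasiintegrable A xi :
  (forall x, A x -> 0 <= xi x) -> quasiintegrable P A xi.
Proof.
by move=> xi0; right; rewrite (eq_integral _ _ (ge0_funenegE xi0)) integral0.
Qed.

(** The positive and the negative parts are summed separately; as one of the two
    sums is finite, the limits can be subtracted. *)
Lemma quasi_integral_bigcup (F : (set T)^nat) xi :
  (forall i, measurable (F i)) -> trivIset setT F ->
  measurable_fun setT xi -> quasiintegrable P (\bigcup_n F n) xi ->
  (fun n => \sum_(0 <= i < n) \int[P]_(x in F i) xi x) @ \oo -->
  \int[P]_(x in \bigcup_n F n) xi x.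
Proof.
move=> mF tF mxi qxi; rewrite integralE.
rewrite (_ : (fun n => _) = (fun n =>
    \sum_(0 <= i < n) \int[P]_(x in F i) xi^\+ x -
    \sum_(0 <= i < n) \int[P]_(x in F i) xi^\- x)); last first.
  apply/funext => n; rewrite -sumeN; last first.
    by move=> i j _ _; apply: ge0_adde_def; rewrite inE integral_ge0.
  by rewrite -big_split/=; apply: eq_bigr => i _; rewrite integralE.
have cvg g : measurable_fun setT g -> (forall x, 0 <= g x) ->
    (fun n => \sum_(0 <= i < n) \int[P]_(x in F i) g x) @ \oo -->
    \int[P]_(x in \bigcup_n F n) g x.
  move=> mg g0; rewrite ge0_integral_bigcup//; last exact: measurable_funTS.
  by apply: is_cvg_nneseries => n _ _; exact: integral_ge0.
apply: cvgeB; [|apply: cvg => //; exact: measurable_funepos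
               |apply: cvg => //; exact: measurable_funeneg].
by case: qxi => ?; [rewrite fin_num_adde_defr|rewrite fin_num_adde_defl// fin_numN].
Qed.

(** The part of [xi] with a finite integral over [B] bounds the integrals over
    all subsets of [B] on one side; this excludes one infinite value. *)
Lemma mu_of_partial_measure xi :
  measurable_fun setT xi -> partial_measure (mu_of P xi).
Proof.
move=> mxi.
have trB B C : measurable B -> strace measurable B C ->
    measurable C /\ C `<=` B.
  by move=> mB [X mX <-]; split; [exact: measurableI|exact: subIsetr].
split; [|by move=> A []|].
  exists set0; split; first exact: measurable0.
  by left; rewrite integral_set0.
move=> B [mB qB]; have mxiB : measurable_fun B xi by exact: measurable_funTS.
split.
  move=> C /(trB _ _ mB)[mC CB]; split => //; exact: quasiintegrableS qB.
split; first by rewrite /= integral_set0.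
  case: qB => [pfin|nfin]; [left|right] => C /(trB _ _ mB)[mC CB] /=.
    rewrite -ltey; apply: (@le_lt_trans _ _ (\int[P]_(x in B) xi^\+ x));
      last by rewrite ltey_eq pfin.
    apply: (@le_trans _ _ (\int[P]_(x in C) xi^\+ x)).
      apply: le_integral_of_le => //; [exact: measurable_funTS
        |exact/measurable_funepos/measurable_funTS
        |by move=> x _; rewrite funeposE le_max lexx].
    by apply: ge0_subset_integral => //; exact: measurable_funepos.
  rewrite -ltNye; apply: (@lt_le_trans _ _ (- \int[P]_(x in B) xi^\- x)).
    by rewrite ltNye_eq fin_numN nfin.
  apply: (@le_trans _ _ (- \int[P]_(x in C) xi^\- x)).
    by rewrite leeN2; apply: ge0_subset_integral => //; exact: measurable_funeneg.
  by rewrite (integralE P C xi) -[leLHS]add0e leeD2r// integral_ge0.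
move=> F FB tF; apply: quasi_integral_bigcup => //.
  by move=> i; case: (trB _ _ mB (FB i)).
apply: quasiintegrableS qB => //.
  by apply: bigcup_measurable => i _; case: (trB _ _ mB (FB i)).
by move=> x [i _]; case: (trB _ _ mB (FB i)) => _; exact.
Qed.

(** Comparing on [eta <= r < s <= xi] with two rationals rather than on
    [eta < xi] keeps everything bounded where it matters: [xi >= s] makes [xi]
    quasi-integrable there, although [eta] may be [-oo] and [xi] may be [+oo].
    *)
Lemma ae_le_of_sf_eq xi eta :
  measurable_fun setT xi -> measurable_fun setT eta ->
  sf_eq (mu_of P xi) (mu_of P eta) -> {ae P, forall x, xi x <= eta x}.
Proof.
move=> mxi meta [domE valE].
pose B (rs : rat * rat) := [set x | eta x <= (ratr rs.1)%:E] `&`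
                           [set x | (ratr rs.2)%:E <= xi x].
have mB rs : measurable (B rs).
  apply: measurableI; rewrite -[X in measurable X]setTI.
    exact: emeasurable_fun_infty_c.
  exact: emeasurable_fun_c_infty.
have B0 rs : (rs.1 < rs.2)%R -> P (B rs) = 0.
  move=> rs12.
  have lexi : (ratr rs.2)%:E * P (B rs) <= \int[P]_(x in B rs) xi x.
    rewrite -integral_cst//; apply: le_integral_of_le => //; last by move=> x [].
    exact: measurable_funTS.
  have etale : \int[P]_(x in B rs) eta x <= (ratr rs.1)%:E * P (B rs).
    rewrite -integral_cst//; apply: le_integral_of_le => //; last by move=> x [].
    exact: measurable_funTS.
  have qB : quasiintegrable P (B rs) xi.
    right; rewrite ge0_fin_numE ?integral_ge0//.
    apply: (@le_lt_trans _ _ (\int[P]_(x in B rs) cst `|ratr rs.2|%:E x)).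
      apply: ge0_le_integral => //.
        exact/measurable_funeneg/measurable_funTS.
      move=> x [_ xix]; rewrite funenegE ge_max lee_fin normr_ge0 andbT.
      by rewrite leeNl (le_trans _ xix)// -EFinN lee_fin lerNl -normrN ler_norm.
    by rewrite integral_cst// ltey_eq fin_numM// fin_num_measure.
  have eqI : \int[P]_(x in B rs) xi x = \int[P]_(x in B rs) eta x.
    exact: valE (conj (mB rs) qB).
  move: lexi; rewrite eqI => /le_trans/(_ etale).
  rewrite -[X in _ * X]fineK ?fin_num_measure//.
  rewrite -[X in _ <= _ * X]fineK ?fin_num_measure//.
  rewrite -!EFinM lee_fin -subr_le0 -mulrBl pmulr_rle0 ?subr_gt0 ?ltr_rat//.
  move=> le0.
  apply/eqP; rewrite eq_le measure_ge0 andbT.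
  by rewrite -[leLHS]fineK ?fin_num_measure// lee_fin.
(* The pairs of rationals are enumerated through their codes in [nat]. *)
pose F n := if (unpickle n : option (rat * rat)) is Some rs then
  if (rs.1 < rs.2)%R then B rs else set0 else set0.
apply: (@negligibleS _ _ _ _ (\bigcup_n F n)); last first.
  apply: negligible_bigcup => n; rewrite /F.
  case: unpickle => [rs|]; last exact: negligible_set0.
  case: ifPn => [rs12|_]; last exact: negligible_set0.
  by apply/negligibleP => //; exact: B0.
move=> x /= /negP; rewrite -ltNge => /ereal_rat_between[r /andP[xr rx]].
have [s /andP[rs sx]] := ereal_rat_between rx.
exists (pickle (r, s)); first exact: I.
rewrite /F pickleK -(ltr_rat R) -lte_fin rs; split; exact: ltW.
Qed.

End quasiintegrable.

(** * Exhaustion and gluing *)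

(** The supremum of the measures of countable unions of members of [K] is
    attained, by merging a sequence of unions that approach it; adjoining to
    an optimal union a disjoint member of [K] cannot increase the measure. *)
Lemma exhaustion_sequence d (T : measurableType d) (R : realType)
    (P : {finite_measure set T -> \bar R}) (K : set (set T)) :
  K `<=` measurable -> K set0 ->
  (forall A B, K B -> measurable A -> A `<=` B -> K A) ->
  exists A : (set T)^nat, [/\ forall n, K (A n), trivIset setT A &
    forall C, K C -> C `&` \bigcup_n A n = set0 -> P C = 0].
Proof.
move=> Km K0 KS.
have Kbig (A : (set T)^nat) : (forall n, K (A n)) -> measurable (\bigcup_n A n).
  by move=> KA; apply: bigcup_measurable => n _; exact: Km.
pose S := [set P (\bigcup_n A n) | A in [set A : (set T)^nat | forall n, K (A n)]].
pose s := ereal_sup S.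
have Ss (A : (set T)^nat) : (forall n, K (A n)) -> P (\bigcup_n A n) <= s.
  by move=> KA; apply: ereal_sup_ubound; exists A.
have sfin : s \is a fin_num.
  rewrite ge0_fin_numE; last exact: le_trans (measure_ge0 P _) (Ss (fun=> set0) _).
  apply: (@le_lt_trans _ _ (P setT)); last by rewrite ltey_eq fin_num_measure.
  by apply: ge_ereal_sup => _ [A KA <-]; rewrite le_measure ?inE//; exact: Kbig.
have [A KA Ak] : exists2 A : nat -> (set T)^nat, forall k n, K (A k n) &
    forall k, s - (k.+1%:R^-1)%:E < P (\bigcup_n A k n).
  have /choice[A HA] : forall k : nat, exists A : (set T)^nat,
      (forall n, K (A n)) /\ s - (k.+1%:R^-1)%:E < P (\bigcup_n A n).
    move=> k; have k0 : (0 < k.+1%:R^-1 :> R)%R by rewrite invr_gt0.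
    have [_ [A KA <-] ?] := ub_ereal_sup_adherent k0 sfin.
    by exists A.
  by exists A => k; [case: (HA k)|case: (HA k)].
(* The double sequence [A] is re-indexed by [nat]. *)
pose B m := if unpickle m is Some kn then A kn.1 kn.2 else set0.
have KB m : K (B m) by rewrite /B; case: unpickle.
have sB : P (\bigcup_m B m) = s.
  apply/eqP; rewrite eq_le Ss//=; apply/lee_subgt0Pr => e e0.
  pose k := Num.truncn e^-1.
  have ke : (k.+1%:R^-1 <= e)%R.
    by rewrite invf_ple ?posrE// ltW// truncnS_gt.
  apply: (@le_trans _ _ (s - (k.+1%:R^-1)%:E)).
    by rewrite leeB// lee_fin.
  apply: (le_trans (ltW (Ak k))); rewrite le_measure ?inE//; [exact: Kbig|exact: Kbig|].
  by move=> x [n _ Ax]; exists (pickle (k, n)); [exact: I|rewrite /B pickleK].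
exists (seqDU B); split.
- move=> n; apply: (KS _ (B n)) => //.
    by apply: measurableD; [exact: Km|apply: bigsetU_measurable => *; exact: Km].
  exact: subDsetl.
- exact: trivIset_seqDU.
rewrite -seqDU_bigcup_eq => C KC CB.
pose B' n := if n is m.+1 then B m else C.
have : P (\bigcup_n B' n) <= s by apply: Ss => -[].
have -> : \bigcup_n B' n = C `|` \bigcup_n B n.
  apply/seteqP; split=> [x [[|n] _]/=|x [Cx|[n _ Bx]]];
    [by left|by right; exists n|by exists 0%N|by exists n.+1].
rewrite measureU//; [|exact: Km|exact: Kbig].
rewrite [X in _ + X]sB -[leRHS]add0e leeD2rE// => C0.
by apply/eqP; rewrite eq_le C0 measure_ge0.
Qed.

Lemma glue_measurable d d' (T : measurableType d) (U : measurableType d')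
    (u : U) (A : (set T)^nat) (f : nat -> T -> U) :
  (forall n, measurable (A n)) -> trivIset setT A ->
  (forall n, measurable_fun setT (f n)) ->
  exists2 g : T -> U, measurable_fun setT g & forall n, {in A n, g =1 f n}.
Proof.
move=> mA tA mf.
pose g x := if pselect (exists n, A n x) is left e then f (projT1 (cid e)) x
            else u.
have gA n : {in A n, g =1 f n}.
  move=> x /set_mem Anx; rewrite /g; case: pselect => [e|[]]; last by exists n.
  case: (cid e) => m /= Amx; congr (f _ x).
  by apply: tA => //; exists x.
have mU : measurable (\bigcup_n A n) by exact: bigcup_measurable.
exists g => //; rewrite -(setUv (\bigcup_n A n)).
apply/measurable_funU => //; [exact: measurableC|split].
  apply/measurable_fun_bigcup => // n.
  apply: (@eq_measurable_fun _ _ _ _ _ (f n)); last exact: measurable_funTS.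
  by move=> x xA; rewrite (gA n).
apply: (@eq_measurable_fun _ _ _ _ _ (cst u)) => // x /set_mem nAx.
by rewrite /g; case: pselect => // -[n Anx]; case: nAx; exists n.
Qed.

Definition has_density d (T : measurableType d) (R : realType)
    (P : probability T R) (mu : set_function T R) (A : set T) :=
  exists2 f : T -> \bar R, measurable_fun setT f &
    forall C, measurable C -> C `<=` A -> mu C = \int[P]_(x in C) f x.

(** * Partial measures *)

Section partial_measure.
Context d (T : measurableType d) (R : realType) (mu : set_function T R).
Context (mupm : partial_measure mu).
Implicit Types A B C : set T.

Lemma partial_measure_measurable B : sf_dom mu B -> measurable B.
Proof. by case: mupm => _ + _; exact. Qed.

Lemma strace_subset B C : measurable C -> C `<=` B -> strace measurable B C.
Proof. by move=> mC CB; exists C => //; apply/setIidPl. Qed.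

Lemma partial_measure_domS B C :
  sf_dom mu B -> measurable C -> C `<=` B -> sf_dom mu C.
Proof.
case: mupm => _ _ + DB mC CB => /(_ _ DB)[+ _]; apply; exact: strace_subset.
Qed.

Lemma partial_measure_set0 : mu set0 = 0.
Proof. by case: mupm => -[B DB] _ /(_ _ DB)[_ []]. Qed.

Lemma partial_measure_one_sided B : sf_dom mu B ->
  (forall C, measurable C -> C `<=` B -> mu C != +oo) \/
  (forall C, measurable C -> C `<=` B -> mu C != -oo).
Proof.
by case: mupm => _ _ + DB => /(_ _ DB)[_ [_ [H|H] _]]; [left|right] => C mC CB;
  apply: H; exact: strace_subset.
Qed.

(** Intersecting with [B] gives a set function that is meaningful on all
    measurable sets: the form in which finite additivity and the Radon-Nikodym
    theorem are available. *)
Lemma partial_measure_trace_sigma_additive B : sf_dom mu B ->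
  semi_sigma_additive (fun X => mu (X `&` B)).
Proof.
move=> DB F mF tF mUF; rewrite setI_bigcupl.
have [_ _ /(_ _ DB)[_ [_ _]]] := mupm; apply.
  by move=> i; exists (F i).
exact: trivIset_setIr.
Qed.

Lemma partial_measure_bigcup (F : (set T)^nat) : (forall i, measurable (F i)) ->
  trivIset setT F -> sf_dom mu (\bigcup_n F n) ->
  (fun n => \sum_(0 <= i < n) mu (F i)) @ \oo --> mu (\bigcup_n F n).
Proof.
move=> mF tF DF; have [_ _ /(_ _ DF)[_ [_ _]]] := mupm; apply => // i.
by apply: strace_subset => //; exact: bigcup_sup.
Qed.

Lemma partial_measure_setD B C : sf_dom mu B -> measurable C -> C `<=` B ->
  mu B = mu C + mu (B `\` C).
Proof.
move=> DB mC CB; have mB := partial_measure_measurable DB.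
pose nu X := mu (X `&` B).
have nu0 : nu set0 = 0 by rewrite /nu set0I partial_measure_set0.
have /(semi_additiveW nu0) nuD :=
  semi_sigma_additive_is_additive nu0 (partial_measure_trace_sigma_additive DB).
have mBC : measurable (B `\` C) by exact: measurableD.
have := nuD _ _ mC mBC (measurableU _ _ mC mBC) (setDIK _ _).
by rewrite /nu setDUK// setIid (setIidl CB) (setIidl (@subDsetl _ B C)).
Qed.

Lemma partial_measure_fin_numS B C : sf_dom mu B -> mu B \is a fin_num ->
  measurable C -> C `<=` B -> mu C \is a fin_num.
Proof.
by move=> DB + mC CB; rewrite (partial_measure_setD DB mC CB) fin_numD => /andP[].
Qed.

(** * Densities of absolutely continuous partial measures *)

Context (P : probability T R) (muP : abs_continuous mu P).

Lemma fin_num_has_density A : sf_dom mu A -> mu A \is a fin_num ->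
  has_density P mu A.
Proof.
move=> DA finA; have mA := partial_measure_measurable DA.
pose nu X := mu (X `&` A).
have nu0 : nu set0 = 0 by rewrite /nu set0I partial_measure_set0.
have nufin X : measurable X -> nu X \is a fin_num.
  by move=> mX; apply: (partial_measure_fin_numS DA) => //; exact: measurableI.
pose nuC := isCharge.Build _ _ _ nu nu0 nufin
  (partial_measure_trace_sigma_additive DA).
pose nuc : {charge set T -> \bar R} := HB.pack nu nuC.
have nuP : nuc `<< P.
  move=> N N0 X mX XN; rewrite /nuc/= /nu; apply: (muP _ _).2.
    exact: measurableI.
  by apply: N0; [exact: measurableI|apply: subset_trans XN; exact: subIsetl].
exists (Radon_Nikodym nuc P).
  by have /measurable_int := Radon_Nikodym_integrable nuP.
move=> C mC CA; rewrite -Radon_Nikodym_integral//.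
by rewrite /nuc/= /nu (setIidl CA).
Qed.

(** If [B] has no such subset, then every subset of finite [mu] is null, so that
    the constant function whose value is the infinite value that [mu] may take
    on [B] is a density on [B] itself; thus [B] is null. *)
Lemma exists_has_density B : sf_dom mu B -> P B != 0 ->
  exists C, [/\ C `<=` B, sf_dom mu C, has_density P mu C & P C != 0].
Proof.
move=> DB PB0; apply: contrapT => noC; have mB := partial_measure_measurable DB.
have null C : C `<=` B -> sf_dom mu C -> has_density P mu C -> P C = 0.
  by move=> CB DC fC; apply: contrapT => /eqP PC; apply: noC; exists C.
suff : has_density P mu B.
  by move=> /(null _ (@subset_refl _ B) DB)/eqP; exact/negP.
(* [c] is the infinite value that [mu] is not known to omit below [B]. *)
have [c cy Hc] : exists2 c : \bar R, c = +oo \/ c = -oo &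
    forall C, measurable C -> C `<=` B ->
    mu C = c \/ mu C \is a fin_num.
  have [H|H] := partial_measure_one_sided DB;
    [exists -oo; first by right|exists +oo; first by left] => C mC CB.
    by have := H _ mC CB; case: (mu C) => [r| |]//; [right|left].
  by have := H _ mC CB; case: (mu C) => [r| |]//; [right|left].
exists (cst c) => // C mC CB; rewrite integral_cst//.
have DC := partial_measure_domS DB mC CB.
have [PC0|PC0] := eqVneq (P C) 0;
  first by rewrite (muP mC PC0).2 [X in _ * X]PC0 mule0.
have [muC|/(fin_num_has_density DC)/(null _ CB DC) PC] := Hc _ mC CB; last first.
  by rewrite PC eqxx in PC0.
have PCgt0 : 0 < P C by rewrite lt0e PC0 measure_ge0.
by rewrite muC; case: cy => ->; [rewrite gt0_mulye|rewrite gt0_mulNye].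
Qed.

(** A set [B] of the domain is cut into the pieces where the local densities
    live and a remainder, which is null because otherwise it would contain a
    non-null set with a density, against the choice of the [A n].  Summing over
    the pieces is legitimate only where [xi] is quasi-integrable; the formula on
    the parts of [B] where [xi] has a constant sign is what yields
    quasi-integrability over every [B] of the domain in [sf_ext_density]. *)
Lemma exists_density :
  exists2 xi : T -> \bar R, measurable_fun setT xi &
    forall B, sf_dom mu B -> quasiintegrable P B xi ->
      mu B = \int[P]_(x in B) xi x.
Proof.
pose K A := sf_dom mu A /\ has_density P mu A.
have Km : K `<=` measurable by move=> A [/partial_measure_measurable].
have KS A B : K B -> measurable A -> A `<=` B -> K A.
  move=> [DB [f mf fB]] mA AB; split; first exact: partial_measure_domS AB.
  by exists f => // C mC CA; apply: fB => //; exact: subset_trans AB.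
have K0 : K set0.
  have [D0 mu0] := muP measurable0 (measure0 P).
  by split => //; apply: fin_num_has_density; rewrite ?mu0.
have [A [KA tA maxA]] := exhaustion_sequence P Km K0 KS.
have mA n : measurable (A n) by exact: Km.
have mUA : measurable (\bigcup_n A n) by exact: bigcup_measurable.
have /choice[f Hf] : forall n, exists f : T -> \bar R, measurable_fun setT f /\
    forall C, measurable C -> C `<=` A n -> mu C = \int[P]_(x in C) f x.
  by move=> n; have [_ [f mf fA]] := KA n; exists f.
have [xi mxi xif] := glue_measurable (0 : \bar R) mA tA (fun n => (Hf n).1).
exists xi => // B DB qB; have mB := partial_measure_measurable DB.
have PBA : P (B `\` \bigcup_n A n) = 0.
  apply/eqP/negP => /negP PBA.
  have DBA : sf_dom mu (B `\` \bigcup_n A n).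
    by apply: partial_measure_domS DB _ _; [exact: measurableD|exact: subDsetl].
  have [C [CB DC dC /eqP]] := exists_has_density DBA PBA; apply.
  by apply: maxA => //; rewrite -subset0 => x [/CB[_ nAx] Ax].
(* [B] is cut along the [A n]; the first piece is the null remainder. *)
pose F n := if n is m.+1 then B `&` A m else B `\` \bigcup_n A n.
have UF : \bigcup_n F n = B.
  apply/seteqP; split => [x [[|n] _ []//]|x Bx].
  have [[n _ Anx]|nAx] := pselect ((\bigcup_n A n) x); first by exists n.+1.
  by exists 0%N.
have mF n : measurable (F n).
  by case: n => [|n] /=; [exact: measurableD|exact: measurableI].
have tF : trivIset setT F.
  move=> [|m] [|n] _ _ [x []]//.
  - by move=> [_ nAx] [_ Ax]; case: nAx; exists n.
  - by move=> [_ Ax] [_ nAx]; case: nAx; exists m.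
  - by move=> [_ Amx] [_ Anx]; congr _.+1; apply: tA => //; exists x.
have muF n : mu (F n) = \int[P]_(x in F n) xi x.
  case: n => [|n] /=.
    rewrite (muP (mF 0%N) PBA).2 null_set_integral//; last exact: measurable_funTS.
    exact: mF 0%N.
  have [mfn fn] := Hf n; rewrite fn; [|exact: measurableI|exact: subIsetr].
  by apply: eq_integral => x /set_mem[_ Anx]; rewrite (xif n)// mem_set.
have cvgmu := partial_measure_bigcup mF tF; rewrite UF in cvgmu.
have cvgxi := @quasi_integral_bigcup _ _ _ P F xi mF tF mxi; rewrite UF in cvgxi.
have sumE : (fun n => \sum_(0 <= i < n) mu (F i)) =
    (fun n => \sum_(0 <= i < n) \int[P]_(x in F i) xi x).
  by apply/funext => n; apply: eq_bigr => i _.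
by apply: cvg_unique (cvgmu DB) _ => //; rewrite sumE; exact: cvgxi.
Qed.

(** [mu] is the integral of [xi] on the part of [B] where [xi <= 0] and on the
    part where [xi >= 0]; as it omits one of the infinite values below [B], one
    of these integrals is finite, which is quasi-integrability over [B]. *)
Lemma sf_ext_density (xi : T -> \bar R) : measurable_fun setT xi ->
  (forall B, sf_dom mu B -> quasiintegrable P B xi ->
    mu B = \int[P]_(x in B) xi x) ->
  sf_ext (mu_of P xi) mu.
Proof.
move=> mxi Hxi.
suff q B : sf_dom mu B -> quasiintegrable P B xi.
  split=> [B DB|B DB]; first by split; [exact: partial_measure_measurable|exact: q].
  by rewrite /= -Hxi//; exact: q.
move=> DB; have mB := partial_measure_measurable DB.
pose N := B `&` [set x | xi x <= 0]; pose M := B `&` [set x | 0 <= xi x].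
have mN : measurable N by apply: emeasurable_fun_infty_c => //; exact: measurable_funTS.
have mM : measurable M by apply: emeasurable_fun_c_infty => //; exact: measurable_funTS.
have muN : mu N = \int[P]_(x in N) xi x.
  by apply: Hxi; [exact: partial_measure_domS DB mN (@subIsetl _ _ _)|
    apply: le0_quasiintegrable => x []].
have muM : mu M = \int[P]_(x in M) xi x.
  by apply: Hxi; [exact: partial_measure_domS DB mM (@subIsetl _ _ _)|
    apply: ge0_quasiintegrable => x []].
have intM : \int[P]_(x in B) xi^\+ x = mu M.
  rewrite muM integral_mkcond [RHS]integral_mkcond; congr integral.
  apply/funext => x; rewrite !patchE funeposE in_setI.
  case: (x \in B) => //=; case: ifPn => [/set_mem xi0|/negP xi0]; first exact/max_idPl.
  by apply/max_idPr/ltW; rewrite ltNge; apply/negP => /mem_set.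
have intN : \int[P]_(x in B) xi^\- x = - mu N.
  apply: oppe_inj; rewrite oppeK muN -integral_ge0N//.
  rewrite integral_mkcond [RHS]integral_mkcond; congr integral.
  apply/funext => x; rewrite !patchE funenegE in_setI.
  case: (x \in B) => //=; case: ifPn => [/set_mem xi0|/negP xi0].
    by rewrite (max_idPl _) ?oppeK// oppe_ge0.
  rewrite (max_idPr _) ?oppe0// oppe_le0.
  by apply: ltW; rewrite ltNge; apply/negP => /mem_set.
have [H|H] := partial_measure_one_sided DB; [left|right];
    rewrite ge0_fin_numE ?integral_ge0//.
  by rewrite intM ltey H//; exact: subIsetl.
by rewrite intN lteNl/= ltNye H//; exact: subIsetl.
Qed.

End partial_measure.

Theorem theorem2 (d : measure_display) (T : measurableType d) (R : realType)
    (P : probability T R) (mu : set_function T R)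
    (mumax : maximal_partial_measure mu) (muP : abs_continuous mu P) :
  exists xi : {RV P >-> \bar R},
    sf_eq mu (mu_of P xi) /\
    (forall eta : {RV P >-> \bar R},
       sf_eq mu (mu_of P eta) -> xi = eta %[ae P]).
Proof.
have [mupm muM] := mumax.
have [xi0 mxi0 Hxi0] := exists_density mupm muP.
pose xiM := isMeasurableFun.Build _ _ _ _ xi0 mxi0.
pose xi : {RV P >-> \bar R} := HB.pack xi0 xiM.
have muxi : sf_eq mu (mu_of P xi).
  apply/sf_eq_sym/muM; first exact: mu_of_partial_measure.
  exact: sf_ext_density.
exists xi; split => // eta mueta.
have xieta := sf_eq_trans (sf_eq_sym muxi) mueta.
have le1 := ae_le_of_sf_eq mxi0 (measurable_funPT eta) xieta.
have le2 := ae_le_of_sf_eq (measurable_funPT eta) mxi0 (sf_eq_sym xieta).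
move: le1 le2; apply: filterS2 => x le1 le2 _.
by apply/eqP; rewrite eq_le le1.
Qed.
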